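(* Let $T$ be an unbounded, locally finite metric space with root $o$, and let $\varphi$ and $\psi$ be self-maps of $T$. Then the following are equivalent: (a) $C_\varphi$ and $C_\psi$ are in the same essential component, i.e. the same connected component of $(\mathscr{C}(L^\infty),d_e)$; (b) $C_\varphi$ and $C_\psi$ are in the same essential path component, i.e. the same path component of $(\mathscr{C}(L^\infty),d_e)$; (c) $C_\varphi-C_\psi$ is a compact operator on $L^\infty(T)$.
   Context: A metric space $(T,d)$ with a distinguished point $o$ (the root) is locally finite if for every $M>0$ the set $\{v\in T : d(o,v)<M\}$ is finite; it is unbounded if for every $M>0$ there is $v\in T$ with $d(o,v)\ge M$. $L^\infty=L^\infty(T)$ is the Banach space of bounded functions $f:T\to\mathbb{C}$ with norm $\|f\|_\infty=\sup_{v\in T}|f(v)|$. A self-map of $T$ is an arbitrary function $\varphi:T\to T$; the composition operator is $C_\varphi f=f\circ\varphi$, a bounded linear operator on $L^\infty(T)$. $\mathscr{C}(L^\infty)$ is the set of all composition operators on $L^\infty(T)$. The essential norm of a bounded operator $A$ on $L^\infty(T)$ is $\|A\|_e=\inf\{\|A-K\| : K \text{ compact on } L^\infty(T)\}$, and $d_e(x,y)=\|x-y\|_e$ is a pseudo-metric; $(\mathscr{C}(L^\infty),d_e)$ carries the pseudo-metric topology (open balls form a basis), called the essential norm topology. *)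

(* Defs.v *)
From HB Require Import structures.
From mathcomp Require Import all_boot all_order all_algebra.
From mathcomp Require Import all_classical all_reals all_analysis.
From mathcomp.real_closed Require Import complex.

Set Implicit Arguments.
Unset Strict Implicit.
Unset Printing Implicit Defensive.

Import Order.TTheory GRing.Theory Num.Theory.
Import numFieldNormedType.Exports.

Local Open Scope classical_set_scope.
Local Open Scope ring_scope.
Local Open Scope complex_scope.

(* In a [normedModType R[i]] the norm is valued in R[i]; it is always real, and
   [rnorm] is that real number ([rnormE]). *)
Section real_norm.
Context {R : realType} {V : normedModType R[i]}.
Implicit Types x y : V.

Definition rnorm x : R := complex.Re `|x|.

Lemma rnormE x : `|x| = (rnorm x)%:C.
Proof.
have : 0 <= `|x| by [].
by rewrite /rnorm; case: `|x| => a b; rewrite lecE/= => /andP[/eqP -> _].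
Qed.

Lemma rnorm_ge0 x : 0 <= rnorm x.
Proof. by have := normr_ge0 x; rewrite rnormE ler0c. Qed.

Lemma rnormD x y : rnorm (x + y) <= rnorm x + rnorm y.
Proof. by have := ler_normD x y; rewrite !rnormE -rmorphD lecR. Qed.

Lemma rnormN x : rnorm (- x) = rnorm x.
Proof. by rewrite /rnorm normrN. Qed.

Lemma rnormB x y : rnorm (x - y) <= rnorm x + rnorm y.
Proof. by rewrite -(rnormN y); exact: rnormD. Qed.

Lemma rnorm0 : rnorm (0 : V) = 0.
Proof. by rewrite /rnorm normr0. Qed.

Lemma rnormZ (a : R[i]) x : rnorm (a *: x) = complex.Re `|a| * rnorm x.
Proof.
have := normrZ a x; rewrite rnormE [`|x|]rnormE.
by rewrite -[`|a|]/((Normc.normc a)%:C) -rmorphM => -[].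
Qed.

Lemma rnorm_continuous : continuous rnorm.
Proof.
move=> x; apply/cvgrPdist_lt => e e0.
have ec0 : (0 : R[i]) < e%:C by rewrite ltcR.
have /cvgrPdist_lt /(_ _ ec0) : (id : V -> V) @ x --> x by exact: cvg_id.
apply: filterS => y /=; rewrite rnormE ltcR; apply: le_lt_trans.
rewrite ler_norml; apply/andP; split.
  by rewrite lerNl opprB lerBlDr -(rnormN (x - y)) opprB
    -[leLHS](congr1 rnorm (subrK x y)) rnormD.
by rewrite lerBlDr -[leLHS](congr1 rnorm (subrK y x)) rnormD.
Qed.

End real_norm.

Section essential_norm.
Context {R : realType} {V W : normedModType R[i]}.
Implicit Types A B K L : V -> W.

(* Meaningful only for bounded linear operators: [sup] is 0 on a set that is
   not bounded above. *)
Definition op_norm A : R :=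
  sup [set rnorm (A x) | x in [set x : V | rnorm x <= 1]].

Definition compact_operator : set (V -> W) :=
  [set K | linear K /\ compact (closure (K @` [set x : V | rnorm x <= 1]))].

Definition ess_norm A : R :=
  inf [set op_norm (A \- K) | K in compact_operator].

Definition bounded_on_ball A :=
  exists M : R, forall x, rnorm x <= 1 -> rnorm (A x) <= M.

Lemma op_norm_ub A x : bounded_on_ball A -> rnorm x <= 1 ->
  rnorm (A x) <= op_norm A.
Proof.
move=> [M AM] x1; apply: ub_le_sup; last by exists x.
by exists M => _ [y y1 <-]; exact: AM.
Qed.

Lemma op_norm_le A M : (forall x, rnorm x <= 1 -> rnorm (A x) <= M) ->
  op_norm A <= M.
Proof.
move=> AM; apply: ge_sup; last by move=> _ [y y1 <-]; exact: AM.
by exists (rnorm (A 0)), 0 => //=; rewrite rnorm0.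
Qed.

Lemma op_norm_ge0 A : 0 <= op_norm A.
Proof.
have [[_ bA]|nA] := pselect (has_sup
    [set rnorm (A x) | x in [set x : V | rnorm x <= 1]]); last first.
  by rewrite /op_norm sup_out.
apply: le_trans (rnorm_ge0 (A 0)) _; apply: ub_le_sup => //.
by exists 0 => //=; rewrite rnorm0.
Qed.

Lemma compact_operator_bounded K : compact_operator K -> bounded_on_ball K.
Proof.
move=> [_ cK].
have : compact (rnorm @` closure (K @` [set x : V | rnorm x <= 1])).
  by apply: continuous_compact cK; apply/continuous_subspaceT/rnorm_continuous.
move=> /(@compact_bounded R R^o)[M [_ rM]]; exists (M + 1) => x x1.
rewrite (le_trans (ler_norm _))//.
have M1 : M < M + 1 by rewrite ltrDl.
by apply: (rM _ M1); exists (K x) => //; apply: subset_closure; exists x.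
Qed.

Lemma compact_operator0 : compact_operator (fun=> 0).
Proof.
split=> [a x y|]; first by rewrite scaler0 addr0.
rewrite -precompactE.
have -> : (fun=> 0 : W) @` [set x : V | rnorm x <= 1] = [set 0].
  apply/seteqP; split=> [_ [x _ <-]//|_ ->].
  by exists 0 => //=; rewrite rnorm0.
by apply: compact_precompact; [exact: norm_hausdorff|exact: compact_set1].
Qed.

Lemma compact_operatorD K L : compact_operator K -> compact_operator L ->
  compact_operator (K \+ L).
Proof.
move=> [lK cK] [lL cL]; split.
  by move=> a x y; rewrite /= lK lL scalerDr addrACA.
rewrite -precompactE.
set CK := closure (K @` _) in cK; set CL := closure (L @` _) in cL.
pose S := (fun z : W * W => z.1 + z.2) @` (CK `*` CL).
have cS : compact S.
  apply: continuous_compact; last exact: compact_setX.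
  by apply: continuous_subspaceT => z; exact: add_continuous.
apply: (@precompact_subset _ _ S); last first.
  by apply: compact_precompact => //; exact: norm_hausdorff.
move=> _ [x x1 <-]; exists (K x, L x) => //.
by split; apply: subset_closure; exists x.
Qed.

Lemma compact_operatorN K : compact_operator K -> compact_operator (\- K).
Proof.
move=> [lK cK]; split.
  by move=> a x y; rewrite /= lK opprD scalerN.
rewrite -precompactE; set CK := closure (K @` _) in cK.
have cS : compact (-%R @` CK).
  apply: continuous_compact cK.
  by apply: continuous_subspaceT => z; exact: opp_continuous.
apply: (@precompact_subset _ _ (-%R @` CK)); last first.
  by apply: compact_precompact => //; exact: norm_hausdorff.
by move=> _ [x x1 <-]; exists (K x) => //; apply: subset_closure; exists x.
Qed.

Lemma ess_norm_has_inf A :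
  has_inf [set op_norm (A \- K) | K in compact_operator].
Proof.
split; last by exists 0 => _ [K _ <-]; exact: op_norm_ge0.
by eexists; exists (fun=> 0) => //; exact: compact_operator0.
Qed.

Lemma ess_norm_le A K : compact_operator K -> ess_norm A <= op_norm (A \- K).
Proof.
move=> cK; apply: ge_inf; last by exists K.
by have [] := ess_norm_has_inf A.
Qed.

Lemma ess_norm_lt A e : ess_norm A < e ->
  exists2 K, compact_operator K & op_norm (A \- K) < e.
Proof.
move=> Ae; have [_ [K cK <-] Ke] := inf_lt (ess_norm_has_inf A).1 Ae.
by exists K.
Qed.

Lemma ess_norm_ge0 A : 0 <= ess_norm A.
Proof.
apply: lb_le_inf; first by have [] := ess_norm_has_inf A.
by move=> _ [K _ <-]; exact: op_norm_ge0.
Qed.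

Lemma ess_norm_compact K : compact_operator K -> ess_norm K = 0.
Proof.
move=> cK; apply/eqP; rewrite eq_le ess_norm_ge0 andbT.
apply: le_trans (ess_norm_le K cK) _.
by apply: op_norm_le => x _ /=; rewrite subrr rnorm0.
Qed.

Lemma ess_dist_sym A B : ess_norm (A \- B) = ess_norm (B \- A).
Proof.
suff H C D : ess_norm (C \- D) <= ess_norm (D \- C).
  by apply/eqP; rewrite eq_le !H.
apply: lb_le_inf; first by have [] := ess_norm_has_inf (D \- C).
move=> _ [K cK <-].
apply: le_trans (ess_norm_le _ (compact_operatorN cK)) _.
rewrite le_eqVlt; apply/orP; left; apply/eqP; rewrite /op_norm; congr sup.
by apply: eq_imagel => x _ /=; rewrite -rnormN !opprD !opprK (addrC (- C x)).
Qed.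

Lemma bounded_on_ballB A B : bounded_on_ball A -> bounded_on_ball B ->
  bounded_on_ball (A \- B).
Proof.
move=> [M AM] [N BN]; exists (M + N) => x x1 /=.
by rewrite (le_trans (rnormB _ _))// lerD ?AM ?BN.
Qed.

Lemma ess_dist_triangle B A C :
  bounded_on_ball A -> bounded_on_ball B -> bounded_on_ball C ->
  ess_norm (A \- C) <= ess_norm (A \- B) + ess_norm (B \- C).
Proof.
move=> bA bB bC; apply/ler_addgt0Pl => e e0.
have e20 : 0 < e / 2 by rewrite divr_gt0.
have [K cK /ltW Ke] : exists2 K, compact_operator K &
  op_norm ((A \- B) \- K) < ess_norm (A \- B) + e / 2.
  by apply: ess_norm_lt; rewrite ltrDl.
have [L cL /ltW Le] : exists2 L, compact_operator L &
  op_norm ((B \- C) \- L) < ess_norm (B \- C) + e / 2.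
  by apply: ess_norm_lt; rewrite ltrDl.
apply: le_trans (ess_norm_le _ (compact_operatorD cK cL)) _.
rewrite [e]splitr addrC addrACA; apply: le_trans (lerD Ke Le).
apply: op_norm_le => x x1 /=.
have -> : A x - C x - (K x + L x) =
    (A x - B x - K x) + (B x - C x - L x).
  by rewrite opprD [RHS]addrACA; congr (_ + _); rewrite addrA subrK.
rewrite (le_trans (rnormD _ _))// lerD//.
- apply: (@op_norm_ub ((A \- B) \- K)) => //.
  by apply/bounded_on_ballB/compact_operator_bounded => //; exact: bounded_on_ballB.
- apply: (@op_norm_ub ((B \- C) \- L)) => //.
  by apply/bounded_on_ballB/compact_operator_bounded => //; exact: bounded_on_ballB.
Qed.

End essential_norm.

(* [R[i]^o] is R[i] seen as a normed space over itself, with the complex modulus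
   as norm. *)
Section Linf_space.
Context {R : realType} {T : Type}.

Definition bounded_pred : {pred T -> R[i]^o} := fun f => f \in bounded_fun.

Lemma bounded_predP (f : T -> R[i]^o) :
  f \in bounded_pred <-> exists M : R, forall v, rnorm (f v) <= M.
Proof.
have -> : (f \in bounded_pred) = `[< bounded_fun f >] by [].
split=> [/asboolP[M [_ fM]]|[M fM]].
  have M1 : M < M + 1 by rewrite ltrDl.
  exists (complex.Re (M + 1)) => v; have := fM _ M1 v Logic.I.
  by rewrite /= rnormE; case: (M + 1) => a b; rewrite lecE/= => /andP[].
apply/asboolP; exists M%:C; split; first by rewrite realE !ler0c lecR le_total.
move=> N /ltW MN v _ /=; apply: le_trans MN.
by rewrite rnormE lecR.
Qed.

Lemma bounded_pred_submod : submod_closed bounded_pred.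
Proof.
split; first by apply/bounded_predP; exists 0 => v; rewrite rnorm0.
move=> a f g /bounded_predP[M fM] /bounded_predP[N gN]; apply/bounded_predP.
exists (rnorm (a : R[i]^o) * M + N) => v.
rewrite (le_trans (rnormD _ _))// lerD// rnormZ.
by rewrite (ler_wpM2l (rnorm_ge0 (a : R[i]^o))).
Qed.

HB.instance Definition _ :=
  GRing.isSubmodClosed.Build R[i] (T -> R[i]^o) bounded_pred bounded_pred_submod.

End Linf_space.

Record Linf (R : realType) (T : Type) := MkLinf {
  Linf_fun :> T -> R[i]^o ;
  _ : Linf_fun \in bounded_pred }.

Section Linf_normed.
Context {R : realType} {T : Type}.

HB.instance Definition _ := [isSub of Linf R T for @Linf_fun R T].
HB.instance Definition _ := [Choice of Linf R T by <:].
HB.instance Definition _ := [SubChoice_isSubLmodule of Linf R T by <:].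

Implicit Types f g : Linf R T.

Definition Linf_norm f : R := sup [set rnorm (f v) | v in [set: T]].

Lemma Linf_norm_ub f v : rnorm (f v) <= Linf_norm f.
Proof.
have /bounded_predP[M fM] := valP f.
by apply: ub_le_sup; [exists M => _ [w _ <-]; exact: fM|exists v].
Qed.

Lemma Linf_norm_le f M : 0 <= M -> (forall v, rnorm (f v) <= M) ->
  Linf_norm f <= M.
Proof.
move=> M0 fM; have [[v]|T0] := pselect (inhabited T).
  by apply: ge_sup; [exists (rnorm (f v)), v|move=> _ [w _ <-]; exact: fM].
rewrite /Linf_norm (_ : [set _ | _ in _] = set0) ?sup0//.
by rewrite -subset0 => x [v _ _]; apply: T0.
Qed.

Lemma Linf_norm_ge0 f : 0 <= Linf_norm f.
Proof.
have [[v]|T0] := pselect (inhabited T).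
  by apply: le_trans (Linf_norm_ub f v); exact: rnorm_ge0.
rewrite /Linf_norm (_ : [set _ | _ in _] = set0) ?sup0//.
by rewrite -subset0 => x [v _ _]; apply: T0.
Qed.

Let ler_normD f g : (Linf_norm (f + g))%:C <= (Linf_norm f)%:C + (Linf_norm g)%:C.
Proof.
rewrite -rmorphD lecR; apply: Linf_norm_le => [|v].
  by rewrite addr_ge0 ?Linf_norm_ge0.
by rewrite (le_trans (rnormD (f v) (g v)))// lerD ?Linf_norm_ub.
Qed.

Let Linf_normZ_le (a : R[i]) f :
  Linf_norm (a *: f) <= rnorm (a : R[i]^o) * Linf_norm f.
Proof.
apply: Linf_norm_le => [|v]; first by rewrite mulr_ge0 ?rnorm_ge0 ?Linf_norm_ge0.
by rewrite (rnormZ a (f v)) (ler_wpM2l (rnorm_ge0 (a : R[i]^o))) ?Linf_norm_ub.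
Qed.

Let normrZ (a : R[i]) f : (Linf_norm (a *: f))%:C = `|a| * (Linf_norm f)%:C.
Proof.
rewrite -[`|a|]/(`|a : R[i]^o|) rnormE -rmorphM; congr (_%:C).
apply/eqP; rewrite eq_le Linf_normZ_le/=.
have [->|a0] := eqVneq a 0; first by rewrite rnorm0 mul0r Linf_norm_ge0.
have ra0 : 0 < rnorm (a : R[i]^o).
  by rewrite -ltcR -rnormE normr_gt0.
rewrite -ler_pdivlMl//; have := Linf_normZ_le a^-1 (a *: f).
rewrite scalerA mulVf// scale1r => /le_trans; apply.
rewrite ler_wpM2r ?Linf_norm_ge0// -(ler_pM2r ra0) mulVf ?gt_eqF//.
rewrite -(rnormZ a^-1 (a : R[i]^o)) /GRing.scale/= mulVf//.
by rewrite /rnorm normr1.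
Qed.

Let normr0_eq0 f : (Linf_norm f)%:C = 0 -> f = 0.
Proof.
move=> [f0]; apply/val_inj/funext => v; apply/eqP; rewrite -normr_eq0.
rewrite rnormE; apply/eqP; congr (_%:C); apply/eqP.
by rewrite eq_le rnorm_ge0 andbT -f0 Linf_norm_ub.
Qed.

HB.instance Definition _ :=
  Lmodule_isNormed.Build R[i] (Linf R T) ler_normD normrZ normr0_eq0.

Lemma rnorm_LinfE f : rnorm f = sup [set rnorm (f v) | v in [set: T]].
Proof. by []. Qed.

End Linf_normed.

Section composition_operators.
Context {R : realType} {T : Type}.

Lemma comp_bounded (phi : T -> T) (f : Linf R T) : f \o phi \in bounded_pred.
Proof.
have /bounded_predP[M fM] := valP f.
by apply/bounded_predP; exists M => v; exact: fM.
Qed.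

Definition comp_op (phi : T -> T) (f : Linf R T) : Linf R T :=
  MkLinf (comp_bounded phi f).

Lemma comp_op_linear phi : linear (comp_op phi).
Proof. by move=> a f g; apply/val_inj. Qed.

Lemma comp_op_bounded phi : bounded_on_ball (comp_op phi).
Proof.
exists 1 => f; apply: le_trans; apply: Linf_norm_le => [|v].
  exact: rnorm_ge0.
exact: (Linf_norm_ub f (phi v)).
Qed.

End composition_operators.

(* The set of composition operators, as a type carrying the essential norm
   pseudo-metric. *)
Record comp_space (R : realType) (T : Type) := CompSpace {
  comp_space_fun :> Linf R T -> Linf R T ;
  comp_spaceP : range comp_op comp_space_fun }.

Definition comp_pt (R : realType) (T : Type) (phi : T -> T) : comp_space R T :=
  CompSpace (imageT comp_op phi).

Section comp_space_pseudometric.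
Context {R : realType} {T : Type}.

HB.instance Definition _ := gen_eqMixin (comp_space R T).
HB.instance Definition _ := gen_choiceMixin (comp_space R T).

Let ball (A : comp_space R T) (e : R) : set (comp_space R T) :=
  [set B | ess_norm (A \- B) < e].

Let comp_space_bounded (A : comp_space R T) : bounded_on_ball A.
Proof. by have [phi _ <-] := comp_spaceP A; exact: comp_op_bounded. Qed.

Let ball_center A e : 0 < e -> ball A e A.
Proof.
rewrite /ball/= (_ : A \- A = fun=> 0); last by apply/funext => f /=; rewrite subrr.
by rewrite (ess_norm_compact compact_operator0).
Qed.

Let ball_sym A B e : ball A e B -> ball B e A.
Proof. by rewrite /ball/= ess_dist_sym. Qed.

Let ball_triangle A B C e1 e2 : ball A e1 B -> ball B e2 C ->
  ball A (e1 + e2) C.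
Proof.
rewrite /ball/= => AB BC; apply: le_lt_trans (ltrD AB BC).
exact: ess_dist_triangle.
Qed.

HB.instance Definition _ :=
  hasNbhs.Build (comp_space R T) (nbhs_ (entourage_ ball)).

HB.instance Definition _ := @Nbhs_isPseudoMetric.Build R (comp_space R T)
  (entourage_ ball) erefl ball ball_center ball_sym ball_triangle erefl.

Lemma comp_space_ballE (A : comp_space R T) (e : R) :
  pseudometric_structure.ball A e = [set B | ess_norm (A \- B) < e].
Proof. by []. Qed.

End comp_space_pseudometric.

Definition path_component (R : realType) (X : topologicalType) (x : X) : set X :=
  [set y | exists gamma : R -> X,
    [/\ {within `[0, 1], continuous gamma}, gamma 0 = x & gamma 1 = y]].

Definition locally_finite (R : realType) (T : metricType R) (o : T) :=
  forall M : R, 0 < M -> finite_set [set v : T | mdist o v < M].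

Definition unbounded (R : realType) (T : metricType R) (o : T) :=
  forall M : R, 0 < M -> exists v : T, M <= mdist o v.

(* Main.v *)
Require Import Defs.
From mathcomp Require Import all_boot all_order all_algebra.
From mathcomp Require Import finmap.
From mathcomp Require Import all_classical all_reals all_analysis.
From mathcomp.real_closed Require Import complex.

Set Implicit Arguments.
Unset Strict Implicit.
Unset Printing Implicit Defensive.

Import Order.TTheory GRing.Theory Num.Theory.
Import numFieldNormedType.Exports.

Local Open Scope classical_set_scope.
Local Open Scope ring_scope.

(** The essential norm separates composition operators by a uniform gap: if
the essential norm of the difference of two of them is less than 1/2, then the
difference is compact ([ess_close_compact]).  Since compactness of the
difference is an equivalence relation, its classes are the balls of radius 1/2,
hence clopen ([clopen_compact_diff]), and a connected component cannot leave
its class.  Conversely, operators with compact difference are at essential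
distance 0, so the path that jumps from one to the other is continuous
([compact_path]).  Finally, paths have connected images.

The gap comes from the set of values that phi or psi takes at the points where
they differ, [disagreement_values phi psi].  Write D for the difference of the
two composition operators.

If this set is infinite, the indicators of its points are infinitely many unit
vectors, and D sends them to vectors at mutual distance at least 1
([comp_diff_sep]).  A compact K with norm of D - K less than 1/2 would send
them to vectors at mutual distance bounded below by a positive constant, inside
a compact set, which is impossible ([near_compact_separated_finite]).

If this set is finite, D f only depends on the finitely many values f x at its
points x: it is the sum of the f x *: D (indicator of x), so D has finite rank
and is compact ([finite_comp_diff_compact]). *)

(** * Finite rank operators are compact *)

Section rank_one.
Local Open Scope complex_scope.
Context {R : realType} {V W : normedModType R[i]}.

Lemma continuous_real_scale (w : W) : continuous (fun a : R => a%:C *: w).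
Proof.
move=> a; apply/cvgrPdist_lt => e e0.
have [d d0 eE] : exists2 d : R, 0 < d & e = d%:C.
  move: e0; case: e => x y; rewrite ltcE/= => /andP[/eqP -> x0].
  by exists x.
have w1 : 0 < rnorm w + 1 by rewrite ltr_wpDl ?rnorm_ge0.
have /cvgrPdist_lt/(_ (d / (rnorm w + 1))) : (id : R -> R) @ a --> a by exact: cvg_id.
rewrite divr_gt0// => /(_ isT); apply: filterS => b /= ab.
rewrite eE -scalerBl -rmorphB rnormE ltcR rnormZ normc_def/= expr0n/=
  addr0 sqrtr_sqr.
rewrite (le_lt_trans (y := `|a - b| * (rnorm w + 1)))//.
  by rewrite ler_wpM2l ?lerDl.
by rewrite -ltr_pdivlMr.
Qed.

(** The image of the unit ball lies in the image of the square [-1, 1]^2 under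
the continuous map (a, b) |-> (a + ib) w, which is compact because the real
segment is. *)
Lemma compact_operator_rank_one (l : V -> R[i]^o) (w : W) :
  linear l -> (forall x, rnorm x <= 1 -> rnorm (l x) <= 1) ->
  compact_operator (fun x => l x *: w : W).
Proof.
move=> lin_l l1; split.
  by move=> a x y; rewrite /= lin_l scalerDl scalerA.
rewrite -precompactE.
pose Q := `[(-1 : R), 1]%classic.
pose F (z : R * R) : W := z.1%:C *: w + z.2%:C *: ('i *: w).
apply: (@precompact_subset _ _ (F @` (Q `*` Q))); last first.
  apply: compact_precompact; first exact: norm_hausdorff.
  apply: continuous_compact; last by apply: compact_setX; exact: segment_compact.
  apply: continuous_subspaceT => z; apply: cvgD.
    apply: (@continuous_comp _ _ _ fst (fun a : R => a%:C *: w)).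
      exact: cvg_fst.
    exact: continuous_real_scale.
  apply: (@continuous_comp _ _ _ snd (fun a : R => a%:C *: ('i *: w))).
    exact: cvg_snd.
  exact: continuous_real_scale.
move=> _ [x x1 <-]; move: (l1 x x1).
case: (l x) => a b ab1; exists (a, b); last first.
  by rewrite /F/= scalerA -scalerDl [_ +i* _]complexE mulrC.
have ab : a ^+ 2 + b ^+ 2 <= 1.
  have : Num.sqrt (a ^+ 2 + b ^+ 2) <= Num.sqrt 1 by rewrite sqrtr1; exact: ab1.
  by rewrite ler_sqrt ?ler01.
split; rewrite /Q/= in_itv/= -ler_norml -(@ler_pXn2r _ 2)// ?nnegrE// expr1n
  real_normK ?num_real//; apply: le_trans ab.
  by rewrite lerDl sqr_ge0.
by rewrite lerDr sqr_ge0.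
Qed.

Lemma compact_operator_sum (I : Type) (s : seq I) (K : I -> V -> W) :
  (forall i, compact_operator (K i)) ->
  compact_operator (fun x => \sum_(i <- s) K i x).
Proof.
move=> cK; elim: s => [|i s IH].
  rewrite (_ : (fun _ => _) = fun=> 0); first exact: compact_operator0.
  by apply/funext => x; rewrite big_nil.
rewrite (_ : (fun _ => _) = K i \+ (fun x => \sum_(i <- s) K i x)).
  exact: compact_operatorD.
by apply/funext => x; rewrite big_cons.
Qed.

End rank_one.

(** * Separated families and compact perturbations *)

Section separated.
Context {R : realType} {V W : normedModType R[i]}.

(** Finitely many balls of radius d / 2 cover C, and each of them contains at
most one member of a d-separated family. *)
Lemma compact_separated_finite (I : choiceType) (P : set I) (C : set W)
    (u : I -> W) (d : R) : 0 < d -> compact C -> (forall i, P i -> C (u i)) ->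
  (forall i j, P i -> P j -> i != j -> d <= rnorm (u i - u j)) -> finite_set P.
Proof.
move=> d0; rewrite compact_cover => cC uC sep.
pose B (c : W) := [set w | rnorm (w - c) < d / 2].
have d20 : 0 < d / 2 by rewrite divr_gt0.
have [c _||D DC CD] := cC _ C B.
- have -> : B c = (fun w => rnorm (w - c)) @^-1` [set r | r < d / 2] by [].
  apply: open_comp; last exact: open_lt.
  move=> w _; apply: (@continuous_comp _ _ _ (fun w => w - c) rnorm).
    by apply: cvgB; [exact: cvg_id|exact: cvg_cst].
  exact: rnorm_continuous.
- by move=> c Cc; exists c => //; rewrite /B/= subrr rnorm0.
have PD : P `<=` \bigcup_(c in [set` D]) (P `&` u @^-1` B c).
  by move=> i Pi; have [c Dc uc] := CD _ (uC _ Pi); exists c.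
apply: (sub_finite_set PD).
apply: bigcup_finite => // c _.
have [[i [Pi ui]]|/set0P/negP/negPn/eqP ->] :=
  pselect (P `&` u @^-1` B c !=set0); last exact: finite_set0.
suff Pi1 : P `&` u @^-1` B c `<=` [set i].
  exact: sub_finite_set Pi1 (finite_set1 i).
move=> j [Pj uj]; apply: contrapT => /eqP ji.
have := sep _ _ Pj Pi ji; apply/negP; rewrite -ltNge.
rewrite (_ : u j - u i = (u j - c) - (u i - c)); last by rewrite opprB addrA subrK.
by rewrite (le_lt_trans (rnormB _ _))// (splitr d) ltrD.
Qed.

(** If K is compact and D - K has norm r < 1/2, then K moves each D (f i) by at
most r, so the K (f i) are still (1 - 2r)-separated and lie in a compact set. *)
Lemma near_compact_separated_finite (I : choiceType) (P : set I) (D : V -> W)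
    (f : I -> V) : bounded_on_ball D -> ess_norm D < 2^-1 ->
  (forall i, rnorm (f i) <= 1) ->
  (forall i j, P i -> P j -> i != j -> 1 <= rnorm (D (f i) - D (f j))) ->
  finite_set P.
Proof.
move=> bD /ess_norm_lt[K cK DK] f1 sep.
have bDK := bounded_on_ballB bD (compact_operator_bounded cK).
set r := op_norm _ in DK.
have near i : rnorm (D (f i) - K (f i)) <= r by exact: (op_norm_ub bDK (f1 i)).
apply: (@compact_separated_finite _ P _ (K \o f) (1 - (r + r)) _ cK.2).
- by rewrite subr_gt0 (splitr 1) div1r ltrD.
- by move=> i _; apply: subset_closure; exists (f i) => //; exact: f1.
move=> i j Pi Pj ij; rewrite lerBlDr (le_trans (sep i j Pi Pj ij))//=.
rewrite (_ : D _ - D _ = (K (f i) - K (f j)) +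
    ((D (f i) - K (f i)) - (D (f j) - K (f j)))).
  rewrite (le_trans (rnormD _ _))// lerD2l (le_trans (rnormB _ _))//.
  by rewrite lerD.
by rewrite [- (D (f j) - _)]opprB [RHS]addrACA addKr [K (f i) + _]addrC subrK.
Qed.

End separated.

(** * Differences of composition operators *)

Section difference.
Context {R : realType} {T : choiceType}.
Implicit Types phi psi : T -> T.

Lemma Linf_rnorm_ub (f : Linf R T) v : rnorm (f v) <= rnorm f.
Proof. exact: Linf_norm_ub. Qed.

Lemma rnorm_nat_le1 (b : bool) : rnorm (b%:R : R[i]^o) <= 1.
Proof. by case: b; rewrite /rnorm ?normr1 ?normr0 //= ler01. Qed.

Lemma indic_bounded (x : T) :
  (fun v => (v == x)%:R : R[i]^o) \in @bounded_pred R T.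
Proof. by apply/bounded_predP; exists 1 => v; exact: rnorm_nat_le1. Qed.

Definition point_indic (x : T) : Linf R T := MkLinf (indic_bounded x).

Lemma point_indic_le1 x : rnorm (point_indic x) <= 1.
Proof. by apply: Linf_norm_le => // v; exact: rnorm_nat_le1. Qed.

Definition disagreement_values phi psi : set T :=
  [set x | exists2 v, phi v != psi v & x = phi v \/ x = psi v].

Definition comp_diff phi psi : Linf R T -> Linf R T := comp_op phi \- comp_op psi.

Lemma comp_diff_bounded phi psi : bounded_on_ball (comp_diff phi psi).
Proof. by apply: bounded_on_ballB; exact: comp_op_bounded. Qed.

(** Let v be a point where phi and psi differ, with x one of phi v, psi v.  At v
the image of the indicator of x is 1 if x = phi v and -1 if x = psi v, whereas
the image of the indicator of another point y is respectively 0 or -1, and 0 or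
1: evaluating at v gives a gap of at least 1. *)
Lemma comp_diff_sep phi psi x y : disagreement_values phi psi x -> x != y ->
  1 <= rnorm (comp_diff phi psi (point_indic x) -
              comp_diff phi psi (point_indic y)).
Proof.
move=> [v pv xv] xy.
apply: le_trans (Linf_rnorm_ub _ v).
change (1 <= rnorm (((phi v == x)%:R - (psi v == x)%:R
   - ((phi v == y)%:R - (psi v == y)%:R) : R[i]^o))).
case: xv => xE; move: xy; rewrite xE.
- rewrite eqxx => /negPf ->; rewrite eq_sym (negPf pv) subr0 sub0r opprK.
  by rewrite -natrD /rnorm normr_nat -(rmorph_nat (real_complex R)) /= ler1n.
- rewrite eqxx => /negPf ->; rewrite (negPf pv) subr0 sub0r -opprD rnormN.
  by rewrite -natrD /rnorm normr_nat -(rmorph_nat (real_complex R)) /= ler1n.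
Qed.

Lemma disagreement_values_finite phi psi :
  ess_norm (comp_diff phi psi) < 2^-1 -> finite_set (disagreement_values phi psi).
Proof.
move=> small; refine (near_compact_separated_finite
  (comp_diff_bounded phi psi) small point_indic_le1 _).
by move=> x y xP _; exact: comp_diff_sep.
Qed.

Lemma sum_indic (s : seq T) (f : T -> R[i]) y : uniq s -> y \in s ->
  \sum_(x <- s) f x * (y == x)%:R = f y.
Proof.
move=> us ys; rewrite (bigD1_seq y)//= eqxx mulr1 big1 ?addr0// => x.
by rewrite eq_sym => /negPf ->; rewrite mulr0.
Qed.

(** D f is the sum of the f x *: D (indicator of x) over the disagreement
values x: at a point v where phi and psi agree every term vanishes, and
elsewhere phi v and psi v are both disagreement values, so the sum
picks out f (phi v) - f (psi v). *)
Lemma finite_comp_diff_compact phi psi :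
  finite_set (disagreement_values phi psi) -> compact_operator (comp_diff phi psi).
Proof.
move=> /finite_seqP[s0 s0E].
pose s := undup s0.
have sP x : disagreement_values phi psi x -> x \in s by rewrite s0E/= mem_undup.
have -> : comp_diff phi psi =
    fun f => \sum_(x <- s) (f x : R[i]) *: comp_diff phi psi (point_indic x).
  apply/funext => f; apply/val_inj/funext => v.
  rewrite raddf_sum fct_sumE/=.
  change (f (phi v) - f (psi v) =
    \sum_(x <- s) (f x : R[i]) * ((phi v == x)%:R - (psi v == x)%:R)).
  have [->|pv] := eqVneq (phi v) (psi v).
    by rewrite subrr big1// => x _; rewrite subrr mulr0.
  under eq_bigr do rewrite mulrBr.
  rewrite sumrB !sum_indic ?undup_uniq//.
    by apply: sP; exists v => //; right.
  by apply: sP; exists v => //; left.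
apply: compact_operator_sum => x.
apply: (@compact_operator_rank_one R _ _ (fun f : Linf R T => f x)) => //.
by move=> f; apply: le_trans; exact: Linf_rnorm_ub.
Qed.

Lemma comp_diff_compact phi psi :
  ess_norm (comp_diff phi psi) < 2^-1 -> compact_operator (comp_diff phi psi).
Proof. by move=> /disagreement_values_finite/finite_comp_diff_compact. Qed.

End difference.

(** * Connected and path components *)

Section components.
Context {R : realType} {T : choiceType}.
Implicit Types A B C : comp_space R T.

(** The gap: the essential norm of the difference of two composition operators
takes no value in ]0, 1/2[. *)
Lemma ess_close_compact A B :
  ess_norm (A \- B) < 2^-1 <-> compact_operator (A \- B).
Proof.
split; last by move=> /ess_norm_compact ->; rewrite invr_gt0.
have [phi _ <-] := comp_spaceP A; have [psi _ <-] := comp_spaceP B.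
exact: comp_diff_compact.
Qed.

Lemma compact_diff_trans A B C : compact_operator (A \- B) ->
  compact_operator (B \- C) -> compact_operator (A \- C).
Proof.
move=> AB BC; rewrite (_ : A \- C = (A \- B) \+ (B \- C)).
  exact: compact_operatorD.
by apply/funext => f /=; rewrite addrA subrK.
Qed.

Lemma compact_diff_sym A B : compact_operator (A \- B) ->
  compact_operator (B \- A).
Proof.
move=> /compact_operatorN; congr compact_operator.
by apply/funext => f /=; rewrite opprB.
Qed.

Lemma near_compact_diff B : nbhs B [set C : comp_space R T | compact_operator (B \- C)].
Proof.
apply/nbhs_ballP; exists (2^-1) => /=; first by rewrite invr_gt0.
by move=> C; rewrite comp_space_ballE => /ess_close_compact.
Qed.

(** Both the class of A and its complement are unions of classes, and each class
contains the ball of radius 1/2 around any of its members. *)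
Lemma clopen_compact_diff A : clopen [set B : comp_space R T | compact_operator (A \- B)].
Proof.
split; last rewrite -openC.
all: rewrite openE => B /= AB; rewrite /interior.
- apply: filterS (near_compact_diff B) => C /=; exact: compact_diff_trans.
- apply: filterS (near_compact_diff B) => C /= BC AC; apply: AB.
  exact: compact_diff_trans AC (compact_diff_sym BC).
Qed.

Lemma component_compact A B : connected_component setT A B ->
  compact_operator (A \- B).
Proof.
have [oS cS] := clopen_compact_diff A.
move=> [C [CA _ cC] CB].
suff : C `&` [set B : comp_space R T | compact_operator (A \- B)] = C.
  by move=> CE; move: CB; rewrite -CE => -[].
apply: cC.
- exists A; split => //=; rewrite (_ : A \- A = fun=> 0).
    exact: compact_operator0.
  by apply/funext => f /=; rewrite subrr.
- by exists [set B : comp_space R T | compact_operator (A \- B)].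
- by exists [set B : comp_space R T | compact_operator (A \- B)].
Qed.

(** A path that stays at A and jumps to B at time 1 is continuous, because all
its values are at essential distance 0 from one another. *)
Lemma compact_path A B : compact_operator (A \- B) -> path_component R A B.
Proof.
move=> AB; exists (fun t : R => if t == 1 then B else A); split.
- apply: continuous_subspaceT => t U /nbhs_ballP[e /= e0 eU].
  apply: (@nearW _ (nbhs t)) => u; apply: eU; rewrite comp_space_ballE/=.
  have self C : ess_norm (C \- C) < e.
    rewrite (_ : C \- C = fun=> 0); last by apply/funext => f /=; rewrite subrr.
    by rewrite (ess_norm_compact compact_operator0).
  have AB0 : ess_norm (A \- B) < e by rewrite (ess_norm_compact AB).
  have BA0 : ess_norm (B \- A) < e by rewrite ess_dist_sym.
  case: (t == 1); case: (u == 1); [exact: self|exact: BA0|exact: AB0|exact: self].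
- by rewrite eq_sym oner_eq0.
- by rewrite eqxx.
Qed.

Lemma path_sub_component A B : path_component R A B ->
  connected_component setT A B.
Proof.
move=> [g [cg g0 g1]]; exists (g @` `[0, 1]); last first.
  by exists 1 => //=; rewrite in_itv/= lexx ler01.
split=> //; first by exists 0 => //=; rewrite in_itv/= lexx ler01.
exact: connected_continuous_connected (@segment_connected R 0 1) cg.
Qed.

End components.

Theorem mainTheorem2 (R : realType) (T : metricType R) (o : T)
    (hunb : unbounded o) (hfin : locally_finite o) (phi psi : T -> T) :
  (connected_component [set: comp_space R T] (comp_pt R phi) (comp_pt R psi) <->
   path_component R (comp_pt R phi) (comp_pt R psi)) /\
  (path_component R (comp_pt R phi) (comp_pt R psi) <->
   compact_operator (comp_op phi \- comp_op psi : Linf R T -> Linf R T)).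
Proof.
split; split.
- by move=> /component_compact; exact: compact_path.
- exact: path_sub_component.
- by move=> /path_sub_component/component_compact.
- exact: (@compact_path R T (comp_pt R phi) (comp_pt R psi)).
Qed.
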